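(* Let $(T,X,\pi)$ be a topological flow on a Polish space $X$ with $T$ an abelian topological group. Assume: (a) $(T,X,\pi)$ is topologically transitive and $\mathrm{Int}_X(Tx)=\emptyset$ for some $x\in\mathrm{Trans}(T,X)$; (b) there exists a periodic point $p$ in $X$. Then, for any sequence $F_1\subset F_2\subset F_3\subset\cdots$ of compact subsets of $T$, one can find an infinite subset $\Theta$ of $X$ such that for any $k\ge 2$ and any distinct points $x_1,\dots,x_k\in\Theta$ there are two sequences $t_n\in T$ and $s_n\in T\setminus F_n$ ($n=1,2,\dots$) with $$t_n(x_1,\dots,x_k)\to(p,\dots,p)\in X^k\quad\text{and}\quad s_n(x_1,\dots,x_k)\to(x_1,\dots,x_k)\in X^k$$ as $n\to\infty$. That is, $(T,X,\pi)$ is multi-dimensional chaotic.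
   Context: A topological flow $(T,X,\pi)$ consists of a topological group $T$ (not necessarily discrete), a topological space $X$ and a jointly continuous action $\pi\colon T\times X\to X$, $(t,x)\mapsto tx$, with $s(tx)=(st)x$ and $ex=x$, where $e$ is the neutral element. $T$ acts on $X^k$ by $t(x_1,\dots,x_k)=(tx_1,\dots,tx_k)$. $Tx=\{tx : t\in T\}$ and $\mathrm{Trans}(T,X)=\{x\in X : \overline{Tx}=X\}$. $\mathrm{Int}_X A$ is the interior of $A$ in $X$. $(T,X,\pi)$ is topologically transitive if for all nonempty open $U,V\subseteq X$ there is $t\in T$ with $U\cap t^{-1}V\neq\emptyset$, where $t^{-1}V=\{x : tx\in V\}$. A subset $B\subseteq T$ is syndetic if there is a compact $K\subseteq T$ with $Kt\cap B\neq\emptyset$ for all $t\in T$. A point $x$ is periodic if $\{t\in T : tx=x\}$ is syndetic in $T$. $(T,X,\pi)$ is multi-dimensional chaotic if for every increasing sequence $\{F_n\}_{n\ge1}$ of compact subsets of $T$ there is an infinite set $\Theta\subseteq X$ such that for any $k\ge2$ and any distinct $x_1,\dots,x_k\in\Theta$ there are sequences $\{s_n\},\{t_n\}$ in $T$ and a point $p\in X$ with $s_n\notin F_n$ for all $n$, $s_n(x_1,\dots,x_k)\to(x_1,\dots,x_k)$ and $t_n(x_1,\dots,x_k)\to(p,\dots,p)$ as $n\to\infty$. *)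

(* Defs.v *)
From HB Require Import structures.
From mathcomp Require Import all_boot all_order all_algebra.
From mathcomp Require Import all_classical all_reals all_analysis.

Set Implicit Arguments.
Unset Strict Implicit.
Unset Printing Implicit Defensive.

Local Open Scope classical_set_scope.
Local Open Scope group_scope.

(* MathComp-Analysis only has additive (hence abelian) topological groups. *)
HB.mixin Record isTopologicalGroup T & Topological T & monoid.Group T := {
  mulg_continuous : continuous (fun st : T * T => st.1 * st.2) ;
  invg_continuous : continuous (fun t : T => t^-1)
}.

#[short(type="topologicalGroupType")]
HB.structure Definition TopologicalGroup :=
  {T of Topological T & monoid.Group T & isTopologicalGroup T}.

(* The library's completeType bundles a default point; this is its completeness
   axiom alone, for possibly empty spaces. *)
Definition complete_uniform (M : uniformType) : Prop :=
  forall F : set_system M, ProperFilter F -> cauchy F -> exists x : M, F --> x.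

Definition homeomorphism (X Y : topologicalType) (f : X -> Y) : Prop :=
  continuous f /\
  exists g : Y -> X, [/\ cancel f g, cancel g f & continuous g].

Definition completely_metrizable (R : realType) (X : topologicalType) : Prop :=
  exists M : metricType R, complete_uniform M /\
    exists f : X -> M, homeomorphism f.

Definition separable (X : topologicalType) : Prop :=
  exists2 D : set X, countable D & dense D.

Definition polish (R : realType) (X : topologicalType) : Prop :=
  separable X /\ completely_metrizable R X.

Record flow (T : topologicalGroupType) (X : topologicalType) := Flow {
  flow_act :> T -> X -> X ;
  flow_continuous : continuous (fun tx : T * X => flow_act tx.1 tx.2) ;
  flow_actM : forall s t x, flow_act s (flow_act t x) = flow_act (s * t) x ;
  flow_act1 : forall x, flow_act 1 x = x
}.

Section flow_notions.
Context (T : topologicalGroupType) (X : topologicalType) (phi : flow T X).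

Definition act_pow k (t : T) (x : 'I_k -> X) : 'I_k -> X := fun i => phi t (x i).

Definition flow_orbit (x : X) : set X := [set phi t x | t in [set: T]].

Definition Trans : set X := [set x | closure (flow_orbit x) = [set: X]].

Definition topologically_transitive : Prop :=
  forall U V : set X, open U -> open V -> U !=set0 -> V !=set0 ->
  exists t : T, U `&` [set x | V (phi t x)] !=set0.

Definition syndetic (B : set T) : Prop :=
  exists2 K : set T, compact K &
    forall t : T, [set k * t | k in K] `&` B !=set0.

Definition periodic_point (x : X) : Prop := syndetic [set t | phi t x = x].

(* Sequences indexed by n >= 1 are reindexed to start at n = 0; X^k is 'I_k -> X
   with the product topology ({ptws _ -> _}). *)
Definition multidimensional_chaotic : Prop :=
  forall F : nat -> set T,
  (forall n, compact (F n)) -> (forall n, F n `<=` F n.+1) ->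
  exists2 Theta : set X, infinite_set Theta &
    forall (k : nat) (x : 'I_k -> X), (2 <= k)%N ->
    injective x -> (forall i, Theta (x i)) ->
    exists (s t : nat -> T) (p : X),
      [/\ forall n, ~ F n (s n),
          {ptws, (fun n => act_pow (s n) x) @ \oo --> x} &
          {ptws, (fun n => act_pow (t n) x) @ \oo --> ((fun=> p) : 'I_k -> X)}].

End flow_notions.

(* Main.v *)
Require Import Defs.
From mathcomp Require Import all_boot all_order all_algebra.
From mathcomp Require Import all_classical all_reals all_analysis.

Set Implicit Arguments.
Unset Strict Implicit.
Unset Printing Implicit Defensive.

Local Open Scope classical_set_scope.
Local Open Scope group_scope.

(** One transitive point [x] with orbit of empty interior produces the whole
    scrambled set: [Theta] is the orbit of [x] under the stabilizer [S] of [p].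

    Since [T] is abelian, every translation [phi g] commutes with the action.
    So if [t_n x] tends to [p] (density of the orbit) and [g] fixes [p], then
    [t_n (g x) = g (t_n x)] tends to [g p = p]; and if [s_n x] tends to [x],
    then [s_n (g x)] tends to [g x].  The same two sequences thus serve all
    finite families of points of [Theta] at once.

    What remains is that [s_n] can avoid the compact set [F_n] and that [Theta]
    is infinite.  Both follow from one fact: a compact subset [C] of the orbit
    cannot contain the part of the orbit lying in a nonempty open set [U].
    Indeed [C] is closed, so by density it would contain [U], and the orbit
    would have interior points ([orbit_leaves_compact]).  For [s_n], take
    [C = F_n x] ([recurrence_off_compact]).  For [Theta], syndeticity of [S]
    gives [T x = K^-1 (S x)] with [K] compact, which would be compact if [S x]
    were finite ([syndetic_orbit_infinite]).

    A metric on [X] makes compact sets closed and gives countable neighborhood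
    bases, which turn density and recurrence into convergent sequences. *)

Lemma injective_continuous_hausdorff (X Y : topologicalType) (f : X -> Y) :
  injective f -> continuous f -> hausdorff_space Y -> hausdorff_space X.
Proof.
move=> finj fcont hY x y clxy; apply: finj; apply: hY => A B nA nB.
by have [z [Az Bz]] := clxy _ _ (fcont x A nA) (fcont y B nB); exists (f z).
Qed.

Lemma completely_metrizable_hausdorff (R : realType) (X : topologicalType) :
  completely_metrizable R X -> hausdorff_space X.
Proof.
move=> [M [_ [f [fcont [g [fK _ _]]]]]].
exact: injective_continuous_hausdorff (can_inj fK) fcont (@metric_hausdorff R M).
Qed.

Lemma completely_metrizable_local_base (R : realType) (X : topologicalType)
    (x : X) :
  completely_metrizable R X ->
  exists2 B : nat -> set X, forall n, nbhs x (B n) &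
    forall U, nbhs x U -> \forall n \near \oo, B n `<=` U.
Proof.
move=> [M [_ [f [fcont [g [fK _ gcont]]]]]].
exists (fun n => f @^-1` ball (f x) (n.+1%:R^-1 : R)%R) => [n|U Ux].
  by apply: fcont; apply: nbhsx_ballx; rewrite Num.Theory.invr_gt0 Num.Theory.ltr0n.
have : nbhs (f x) (g @^-1` U) by apply: gcont; rewrite fK.
move=> /nbhs_ballP[e /= e0 eU].
near=> n; move=> y /= fxy.
rewrite -(fK y); apply: eU; apply: le_ball fxy.
by apply: Order.POrderTheory.ltW; near: n; exact: (near_infty_natSinv_lt (PosNum e0)).
Unshelve. all: by end_near. Qed.

(** The property [Q n] lets the [n]-th term be chosen under a constraint that
    varies with [n]. *)
Lemma cvg_constrained_sequence (R : realType) (X : topologicalType) (T : Type)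
    (f : T -> X) (x : X) (Q : nat -> set T) :
  completely_metrizable R X ->
  (forall n U, nbhs x U -> exists2 t, Q n t & U (f t)) ->
  exists2 t : nat -> T, forall n, Q n (t n) & f (t n) @[n --> \oo] --> x.
Proof.
move=> /completely_metrizable_local_base - /(_ x)[B nB Bbase] ex.
have /choice[t tP] : forall n, exists t, Q n t /\ B n (f t).
  by move=> n; have [t] := ex n _ (nB n); exists t.
exists t => [n|U Ux]; first by have [] := tP n.
apply: filterS (Bbase U Ux) => n BU.
by apply: BU; have [] := tP n.
Qed.

Lemma cvg_ptws (I : Type) (X : topologicalType) (u : nat -> I -> X)
    (l : I -> X) :
  (forall i, u n i @[n --> \oo] --> l i) -> {ptws, u @ \oo --> l}.
Proof.
move=> ul; apply/cvg_sup => i A [_ [[B oB <-] Bl BA]].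
by apply: filterS BA _; apply: (ul i); exact: open_nbhs_nbhs.
Qed.

Section Flow.
Context (T : topologicalGroupType) (X : topologicalType) (phi : flow T X).

Lemma flow_continuousr (t : T) : continuous (phi t).
Proof.
move=> x.
apply: (@cvg_comp2 _ _ _ _ (nbhs x) (nbhs t) (nbhs x) (nbhs (phi t x))
  _ _ _ (fun=> t) id phi).
- exact: cvg_cst.
- exact: cvg_id.
- exact: (@flow_continuous _ _ phi (t, x)).
Qed.

Lemma compact_flow_image (K : set T) (Y : set X) :
  compact K -> compact Y -> compact [set phi ky.1 ky.2 | ky in K `*` Y].
Proof.
move=> cK cY; apply: continuous_compact; last exact: compact_setX.
exact/continuous_subspaceT/flow_continuous.
Qed.

Lemma Trans_meets_open (x : X) (U : set X) :
  Trans phi x -> open U -> U !=set0 -> exists t, U (phi t x).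
Proof.
move=> xT oU [y Uy].
have : closure (flow_orbit phi x) y by rewrite xT.
by move=> /(_ U (open_nbhs_nbhs (conj oU Uy)))[_ [[t _ <-] Ut]]; exists t.
Qed.

Hypothesis hX : hausdorff_space X.
Variable x : X.
Hypothesis x_trans : Trans phi x.
Hypothesis orbit_int0 : interior (flow_orbit phi x) = set0.

(** Density of the orbit would otherwise put all of [U] inside the closed set
    [C], hence inside the orbit, whose interior is empty. *)
Lemma orbit_leaves_compact (C U : set X) :
  compact C -> C `<=` flow_orbit phi x -> open U -> U !=set0 ->
  exists2 t, U (phi t x) & ~ C (phi t x).
Proof.
move=> cC Corb oU [y Uy]; apply: contrapT => orbC.
suff : interior (flow_orbit phi x) y by rewrite orbit_int0.
apply: filterS (open_nbhs_nbhs (conj oU Uy)) => z Uz.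
apply: Corb; apply: contrapT => Cz.
(* [U] minus the closed set [C] is open and nonempty, so the orbit enters it *)
have [|t [Ut Ct]] := Trans_meets_open x_trans
    (openI oU (closed_openC (compact_closed hX cC))).
  by exists z.
by apply: orbC; exists t.
Qed.

(** The times in [K] only move [x] within the compact set [K x], which the orbit
    leaves inside every neighborhood of [x]. *)
Lemma recurrence_off_compact (K : set T) (U : set X) :
  compact K -> nbhs x U -> exists2 s, ~ K s & U (phi s x).
Proof.
move=> cK; rewrite nbhsE => -[V [oV Vx] VU].
have cKx := compact_flow_image cK (@compact_set1 _ x).
have [||t Vt Kt] := orbit_leaves_compact cKx _ oV.
- by move=> _ [[k z] [_ /= ->] <-]; exists k.
- by exists x.
exists t; last exact: VU.
by move=> tK; apply: Kt; exists (t, x).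
Qed.

(** A compact set of inverses carries [S x] onto the whole orbit, so finiteness
    of [S x] would make the orbit compact. *)
Lemma syndetic_orbit_infinite (S : set T) :
  syndetic S -> infinite_set [set phi g x | g in S].
Proof.
move=> [K cK KS] finSx.
have cKV : compact [set k^-1 | k in K].
  apply: continuous_compact cK.
  exact/continuous_subspaceT/invg_continuous.
have cC := compact_flow_image cKV (finite_compact finSx).
have [||t _] := orbit_leaves_compact cC _ openT.
- move=> _ [[_ _] [[k _ <-] [g _ <-]] <-] /=.
  by exists (k^-1 * g) => //; rewrite flow_actM.
- by exists x.
(* [t = k^-1 (k t)] with [k] in [K] and [k t] in [S] *)
apply; have [_ [[k kK <-] ktS]] := KS t.
exists (k^-1, phi (k * t) x) => /=; last by rewrite flow_actM mulKg.
by split; [exists k|exists (k * t)].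
Qed.

End Flow.

(** One sequence of times serves all translates of [x], because [t_n] commutes
    with [g]. *)
Lemma abelian_cvg_translate (T : topologicalGroupType) (X : topologicalType)
    (phi : flow T X) (t : nat -> T) (x y : X) (g : T) :
  (forall s t : T, s * t = t * s) ->
  phi (t n) x @[n --> \oo] --> y ->
  phi (t n) (phi g x) @[n --> \oo] --> phi g y.
Proof.
move=> abelianT txy.
under eq_fun do rewrite flow_actM abelianT -flow_actM.
apply: cvg_comp txy _; exact: (@flow_continuousr _ _ phi g y).
Qed.

Theorem proposition2p14 (R : realType) (T : topologicalGroupType)
    (X : topologicalType) (phi : flow T X)
    (abelianT : forall s t : T, s * t = t * s)
    (polishX : polish R X)
    (transitive_phi : topologically_transitive phi)
    (empty_interior : exists2 x : X, Trans phi x &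
       interior (flow_orbit phi x) = set0)
    (p : X) (periodic_p : periodic_point phi p) :
  (forall F : nat -> set T,
     (forall n, compact (F n)) -> (forall n, F n `<=` F n.+1) ->
     exists2 Theta : set X, infinite_set Theta &
       forall (k : nat) (x : 'I_k -> X), (2 <= k)%N ->
       injective x -> (forall i, Theta (x i)) ->
       exists t s : nat -> T,
         [/\ forall n, ~ F n (s n),
             {ptws, (fun n => act_pow phi (t n) x) @ \oo
                      --> ((fun=> p) : 'I_k -> X)} &
             {ptws, (fun n => act_pow phi (s n) x) @ \oo --> x}])
  /\ multidimensional_chaotic phi.
Proof.
rewrite /multidimensional_chaotic; set chaotic_to_p := (X in X /\ _).
(* the limit [p] does not depend on the chosen points, so the first half is
   the stronger one *)
suff H : chaotic_to_p.
  split=> // F cF incF; have [Th infTh ThP] := H F cF incF.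
  exists Th => // k y k2 yinj yTh.
  by have [t [s [sF tp sy]]] := ThP k y k2 yinj yTh; exists s, t, p.
move=> F cF _.
have [x xT xint] := empty_interior.
have [_ mX] := polishX.
have hX := completely_metrizable_hausdorff mX.
exists [set phi g x | g in [set g | phi g p = p]].
  exact: syndetic_orbit_infinite.
have [t _ txp] : exists2 t : nat -> T, forall n, setT (t n) &
    phi (t n) x @[n --> \oo] --> p.
  apply: (cvg_constrained_sequence (f := phi^~ x) (Q := fun=> setT) mX) => _ U.
  rewrite nbhsE => -[V [oV Vp] VU].
  have [|r Vr] := Trans_meets_open xT oV; first by exists p.
  by exists r => //; exact: VU.
have [s sF sxx] : exists2 s : nat -> T, forall n, ~ F n (s n) &
    phi (s n) x @[n --> \oo] --> x.
  apply: (cvg_constrained_sequence (f := phi^~ x) (Q := fun n => ~` F n) mX).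
  by move=> n U; exact: recurrence_off_compact.
move=> k y _ _ yTh; exists t, s; split => //.
- apply: cvg_ptws => i; have [g gp gx] := yTh i.
  rewrite /act_pow -gx -[X in _ --> X]gp.
  exact: abelian_cvg_translate.
- apply: cvg_ptws => i; have [g _ gx] := yTh i.
  rewrite /act_pow -gx.
  exact: abelian_cvg_translate.
Qed.
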